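(* The class $\mathscr B$ of all complete bipartite graphs is weakly $\chi_p$-bounded but not strongly $\chi_p$-bounded.
   Context: $\omega(G)$ is the clique number of a graph $G$; for a class $\mathscr D$ of graphs, $\omega(\mathscr D)=\sup_{G\in\mathscr D}\omega(G)$. For a non-negative integer $r$, ${\rm TM}_r(G)$ is the class of all graphs $H$ such that some graph obtained from $H$ by subdividing each edge by at most $r$ vertices is a subgraph of $G$. The tree-depth ${\rm td}(G)$ is the minimum height (number of vertices on a longest root-to-leaf path) of a rooted forest $Y$ such that $G$ is a subgraph of the closure of $Y$ (the graph in which each vertex is adjacent to all its ancestors in $Y$). For a positive integer $p$, $\chi_p(G)$ is the minimum number of colors in a vertex coloring of $G$ such that every set $I$ of at most $p$ colors induces a subgraph of $G$ with tree-depth at most $|I|$. A class is hereditary if it is closed under induced subgraphs. A hereditary class $\mathscr C$ is strongly $\chi_p$-bounded if there is a fixed function $f_p$ with $\chi_p(G)\leq f_p(\omega(G))$ for every $G\in\mathscr C$; it is weakly $\chi_p$-bounded if there is a fixed function $g_p$ with $\chi_p(G)\leq g_p(\omega({\rm TM}_{p-1}(G)))$ for every $G\in\mathscr C$. When $p$ is not specified, as in the claim, ''weakly (respectively strongly) $\chi_p$-bounded'' means that the property holds for every positive integer $p$; so the negative part says that the property fails for at least one $p$. *)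

(* Defs.v *)
(* Classical logic is used only to select minima and suprema of
   undecided sets of natural numbers. *)
From mathcomp Require Import all_boot all_order.
From mathcomp Require Import boolp.
From mathcomp Require classical_sets.

Set Implicit Arguments.
Unset Strict Implicit.
Unset Printing Implicit Defensive.

Record sgraph := SGraph {
  vertex :> finType;
  adj : rel vertex;
  adj_sym : symmetric adj;
  adj_irrefl : irreflexive adj }.

Notation "x -- y" := (adj x y) (at level 30).

(* Subgraphs and induced subgraphs are taken up to isomorphism. *)
Definition subgraph (H G : sgraph) : Prop :=
  exists f : H -> G, injective f /\ forall x y, x -- y -> f x -- f y.

Definition induced_subgraph (H G : sgraph) : Prop :=
  exists f : H -> G, injective f /\ forall x y, x -- y = f x -- f y.

Section Induced.
Variables (G : sgraph) (A : {set G}).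

Let iadj (x y : {x : G | x \in A}) := val x -- val y.

Fact induced_sym : symmetric iadj.
Proof. by move=> x y; rewrite /iadj adj_sym. Qed.

Fact induced_irrefl : irreflexive iadj.
Proof. by move=> x; rewrite /iadj adj_irrefl. Qed.

Definition induced := SGraph induced_sym induced_irrefl.
End Induced.

Definition clique (G : sgraph) (A : {set G}) : bool :=
  [forall x in A, forall y in A, (x != y) ==> x -- y].

Definition omega (G : sgraph) : nat := \max_(A : {set G} | clique A) #|A|.

Definition graph_class := sgraph -> Prop.

(* The supremum in nat, with value 0 if the clique numbers are unbounded. This
   default is never used for the classes TM r G below: see omega_class_TMP. *)
Definition omega_class (D : graph_class) : nat :=
  classical_sets.supremum 0 (fun k => exists2 G, D G & omega G = k).

(* Every edge of H is listed once, oriented along the enumeration of the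
   vertices, so that its subdivision vertices can be numbered from its source
   to its target. *)
Definition oedge (H : sgraph) :=
  {e : H * H | e.1 -- e.2 && (enum_rank e.1 < enum_rank e.2)}.

Section Subdivision.
Variables (H : sgraph) (l : oedge H -> nat).

(* Each edge e of H is replaced with a path with l e inner vertices. *)
Definition sub_vertex : finType := (H + {e : oedge H & 'I_(l e)})%type.

Definition sub_arc (x y : sub_vertex) : bool :=
  match x, y with
  | inl u, inl v => [exists e : oedge H, (val e == (u, v)) && (l e == 0)]
  | inl u, inr s => (u == (val (tag s)).1) && (tagged s == 0 :> nat)
  | inr s, inl v => (v == (val (tag s)).2) && ((tagged s).+1 == l (tag s))
  | inr s, inr t => (tag s == tag t) && ((tagged s).+1 == tagged t)
  end.

Let sub_adj x y := sub_arc x y || sub_arc y x.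

Fact subdivision_sym : symmetric sub_adj.
Proof. by move=> x y; rewrite /sub_adj orbC. Qed.

Fact subdivision_irrefl : irreflexive sub_adj.
Proof.
move=> x; rewrite /sub_adj orbb; case: x => [u|s] /=.
  apply/existsP => -[[e /= /andP[ee _]] /andP[/eqP E _]].
  by rewrite /= in E; rewrite E adj_irrefl in ee.
by rewrite eqxx /= gtn_eqF.
Qed.

Definition subdivision := SGraph subdivision_sym subdivision_irrefl.
End Subdivision.

Definition TM (r : nat) (G : sgraph) : graph_class := fun H =>
  exists l : oedge H -> nat,
    (forall e, l e <= r) /\ subgraph (subdivision l) G.

Lemma omega_le_card (G : sgraph) : omega G <= #|G|.
Proof. by apply/bigmax_leqP => A _; apply: max_card. Qed.

Lemma TM_omega_bounded r G H : TM r G H -> omega H <= #|G|.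
Proof.
case=> l [_ [f [finj _]]]; apply: leq_trans (omega_le_card H) _.
by apply: (@leq_card _ _ (f \o inl)) => x y /finj [].
Qed.

Lemma omega_class_TMP r G :
  (exists2 H, TM r G H & omega H = omega_class (TM r G)) /\
  (forall H, TM r G H -> omega H <= omega_class (TM r G)).
Proof.
pose P k := `[< exists2 H, TM r G H & omega H = k >].
have exP : exists k, P k.
  have vsym : symmetric (fun _ _ : void => false) by [].
  have virr : irreflexive (fun _ : void => fun=> false) by [].
  exists (omega (SGraph vsym virr)); apply/asboolP.
  exists (SGraph vsym virr) => //.
  exists (fun=> 0); split=> //.
  have F (x : subdivision (fun _ : oedge (SGraph vsym virr) => 0)) : False.
    by case: x => [[]|[e []]].
  by exists (fun x => False_rect G (F x)); split=> x; case: (F x).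
have ubP k : P k -> k <= #|G|.
  by move=> /asboolP[H HH <-]; apply: TM_omega_bounded HH.
have [m /asboolP Pm maxm] := ex_maxnP exP ubP.
suff -> : omega_class (TM r G) = m.
  by split=> // H HH; apply: maxm; apply/asboolP; exists H.
rewrite /omega_class /classical_sets.supremum; case: ifPn => [/eqP E|_].
  by have : @classical_sets.set0 nat m by rewrite -E.
case: classical_sets.xgetP => [k _ [ubk lubk]|/(_ m)[]].
  apply/eqP; rewrite eqn_leq; apply/andP; split; last exact: ubk.
  by apply: lubk => j [H HH <-]; apply: maxm; apply/asboolP; exists H.
split; last by move=> j ubj; apply: ubj.
by move=> j [H HH <-]; apply: maxm; apply/asboolP; exists H.
Qed.

Definition parent_rel (T : finType) (parent : T -> option T) : rel T :=
  [rel x y | parent x == Some y].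

Record rooted_forest := RootedForest {
  node :> finType;
  parent : node -> option node;
  parent_acyclic :
    forall x y, parent x = Some y -> ~~ connect (parent_rel parent) y x }.

Definition ancestor (Y : rooted_forest) (u v : Y) : bool :=
  (u != v) && connect (parent_rel (@parent Y)) v u.

Definition leaf (Y : rooted_forest) (v : Y) : bool :=
  [forall u, parent u != Some v].

(* The vertices of the path from v to its root are the nodes that are reachable
   from v by following parents. *)
Definition depth (Y : rooted_forest) (v : Y) : nat :=
  #|[set u | connect (parent_rel (@parent Y)) v u]|.

Definition height (Y : rooted_forest) : nat := \max_(v : Y | leaf v) depth v.

Section Closure.
Variable Y : rooted_forest.

Let cadj (u v : Y) := ancestor u v || ancestor v u.

Fact closure_sym : symmetric cadj.
Proof. by move=> u v; rewrite /cadj orbC. Qed.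

Fact closure_irrefl : irreflexive cadj.
Proof. by move=> u; rewrite /cadj /ancestor eqxx. Qed.

Definition closure := SGraph closure_sym closure_irrefl.
End Closure.

Definition td_witness (G : sgraph) (h : nat) : Prop :=
  exists Y : rooted_forest, height Y = h /\ subgraph G (closure Y).

Section PathForest.
Variable n : nat.

Definition path_parent (i : 'I_n) : option 'I_n :=
  if i is Ordinal k.+1 lt_k then Some (Ordinal (ltnW lt_k)) else None.

Lemma path_parentE (i j : 'I_n) :
  (path_parent i == Some j) = (nat_of_ord i == j.+1).
Proof. by case: i => -[|k] ltk. Qed.

Lemma connect_path_parent (i j : 'I_n) :
  connect (parent_rel path_parent) i j = (j <= i).
Proof.
apply/idP/idP => [/connectP[p]|].
  elim: p i => [|k p IH] i /=; first by move=> _ ->.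
  rewrite [parent_rel _ _ _]path_parentE => /andP[/eqP -> /IH{}IH] /IH le_jk.
  exact: leqW.
case: i => i lti; elim: i lti => [|i IH] lti /=.
  by rewrite leqn0 => /eqP j0; apply: eq_connect0; apply: val_inj.
rewrite leq_eqVlt => /orP[/eqP ji|lt_ji]; first exact/eq_connect0/val_inj.
apply: connect_trans (IH (ltnW lti) lt_ji); apply: connect1.
by rewrite [parent_rel _ _ _]path_parentE.
Qed.

Fact path_acyclic x y :
  path_parent x = Some y -> ~~ connect (parent_rel path_parent) y x.
Proof.
by move/eqP; rewrite path_parentE connect_path_parent -ltnNge => /eqP ->.
Qed.

Definition path_forest := RootedForest path_acyclic.

Lemma height_path_forest : height path_forest <= n.
Proof.
by apply/bigmax_leqP => v _; apply: leq_trans (max_card _) _; rewrite card_ord.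
Qed.
End PathForest.

Lemma path_td_witness (G : sgraph) : td_witness G (height (path_forest #|G|)).
Proof.
exists (path_forest #|G|); split=> //; exists enum_rank; split.
  exact: enum_rank_inj.
move=> x y xy; have ne_xy : x != y.
  by apply/eqP => E; rewrite E adj_irrefl in xy.
have ne : enum_rank x != enum_rank y by rewrite (inj_eq enum_rank_inj).
rewrite /= /ancestor !connect_path_parent ne eq_sym ne /=.
exact: leq_total.
Qed.

Fact td_exists (G : sgraph) : exists h, `[< td_witness G h >].
Proof. by eexists; apply/asboolP; apply: path_td_witness. Qed.

Definition td (G : sgraph) : nat := ex_minn (td_exists G).

Lemma td_le_card (G : sgraph) : td G <= #|G|.
Proof.
rewrite /td; case: ex_minnP => h _ /(_ (height (path_forest #|G|))) minh.
apply: leq_trans (height_path_forest _); apply: minh.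
exact/asboolP/path_td_witness.
Qed.

Definition td_coloring (p : nat) (G : sgraph) (k : nat)
    (c : {ffun G -> 'I_k}) : bool :=
  [forall I : {set 'I_k}, (#|I| <= p) ==>
     (td (induced [set x | c x \in I]) <= #|I|)].

Fact chi_exists (p : nat) (G : sgraph) :
  exists k, [exists c : {ffun G -> 'I_k}, td_coloring p c].
Proof.
exists #|G|; apply/existsP; exists [ffun x => enum_rank x].
apply/forallP => I; apply/implyP => _; apply: leq_trans (td_le_card _) _.
rewrite card_sig -(card_imset _ (@enum_val_inj _ (mem G))).
apply: subset_leq_card; apply/subsetP => x; rewrite !inE ffunE => xI.
by apply/imsetP; exists (enum_rank x); rewrite ?enum_rankK.
Qed.

Definition chi (p : nat) (G : sgraph) : nat := ex_minn (chi_exists p G).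

Definition hereditary (C : graph_class) : Prop :=
  forall G H, C G -> induced_subgraph H G -> C H.

Definition strongly_chi_bounded_at (p : nat) (C : graph_class) : Prop :=
  exists f : nat -> nat, forall G, C G -> chi p G <= f (omega G).

Definition weakly_chi_bounded_at (p : nat) (C : graph_class) : Prop :=
  exists g : nat -> nat,
    forall G, C G -> chi p G <= g (omega_class (TM p.-1 G)).

Definition strongly_chi_bounded (C : graph_class) : Prop :=
  forall p, 0 < p -> strongly_chi_bounded_at p C.

Definition weakly_chi_bounded (C : graph_class) : Prop :=
  forall p, 0 < p -> weakly_chi_bounded_at p C.

(* The sides A and ~: A may be empty: without edgeless graphs the class would
   not be hereditary. *)
Definition complete_bipartite : graph_class := fun G =>
  exists A : {set G}, forall x y : G, x -- y = ((x \in A) != (y \in A)).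

(* Main.v *)
(* For p = 1 two colours suffice.  For p >= 2, give the vertices of the smaller
   side, of size m, distinct colours and one further colour to the other side:
   hence chi_p <= m + 1.  On the other hand K_{m,n} contains the 1-subdivision
   of K_k as soon as k ^ 2 <= m <= n (branch vertices on one side, subdivision
   vertices on the other), so that m < (omega (TM_(p-1)) + 1) ^ 2.
   Strong boundedness fails at p = 2: omega is at most 2, but if K_{n,n} is
   coloured with fewer than n colours then each side has two vertices of the same
   colour, and these four vertices form a 4-cycle, of tree-depth 3, that uses at
   most two colours. *)
Require Import Defs.
From mathcomp Require Import all_boot all_order.
From mathcomp Require Import boolp.

Set Implicit Arguments.
Unset Strict Implicit.
Unset Printing Implicit Defensive.

(** * Tree-depth and root paths *)

Lemma adj_neq (G : sgraph) (x y : G) : x -- y -> x != y.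
Proof. by apply: contraTneq => ->; rewrite adj_irrefl. Qed.

Lemma td_min (G : sgraph) h : td_witness G h -> td G <= h.
Proof. by rewrite /td; case: ex_minnP => m _ minm /asboolP /minm. Qed.

Lemma td_witness_td (G : sgraph) : td_witness G (td G).
Proof. by rewrite /td; case: ex_minnP => m /asboolP. Qed.

(** [height] looks only at leaves. A node of maximal depth among those with [v] on their root path
    is a leaf, since a child would be strictly deeper by acyclicity. *)
Lemma depth_le_height (Y : rooted_forest) (v : Y) : depth v <= height Y.
Proof.
case: (@arg_maxnP _ v (fun w => connect (parent_rel (@parent Y)) w v)
  (@depth Y) (connect0 _ v)) => w wv maxw.
apply: (@leq_trans (depth w)).
  apply/subset_leq_card/subsetP => u; rewrite !inE.
  exact: connect_trans.
apply: (@leq_bigmax_cond _ (@leaf Y) (@depth Y) w).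
apply/forallP => u; apply/eqP => uw.
have conn_uw : connect (parent_rel (@parent Y)) u w.
  by apply: connect1; apply/eqP.
have : depth u <= depth w := maxw u (connect_trans conn_uw wv).
rewrite leqNgt => /negP; apply.
apply/proper_card/properP; split.
  by apply/subsetP => z; rewrite !inE; apply: connect_trans.
by exists u; rewrite inE ?connect0 // parent_acyclic.
Qed.

(** * Tree-depth and vertex covers *)

Section VertexCover.
Variables (G : sgraph) (S : {set G}).
Hypothesis coverS : forall x y : G, x -- y -> (x \in S) || (y \in S).

(* Equal to #|S| outside S. *)
Let rank (x : G) := index x (enum S).

Let rank_lt x : (rank x < #|S|) = (x \in S).
Proof. by rewrite /rank cardE index_mem mem_enum. Qed.

Let rank_le x : rank x <= #|S|.
Proof. by rewrite /rank cardE index_size. Qed.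

Let rank_inj x y : x \in S -> rank y = rank x -> y = x.
Proof.
move=> xS E; have yS : y \in S by rewrite -rank_lt E rank_lt.
by rewrite -[y](nth_index x (s := enum S)) ?mem_enum // [index _ _]E
  nth_index ?mem_enum.
Qed.

(** The vertices of [S] form a path in the order of [enum S]; every other vertex has rank [#|S|] and
    so hangs below the last vertex of that path, if there is one. *)
Definition cover_parent (x : G) : option G :=
  [pick y in S | (rank y).+1 == rank x].

Lemma cover_parentP x y :
  parent_rel cover_parent x y -> y \in S /\ rank x = (rank y).+1.
Proof.
rewrite /parent_rel /= /cover_parent; case: pickP => // z /andP[zS /eqP rz] /eqP[<-].
by split.
Qed.

Lemma connect_cover_rank x y :
  connect (parent_rel cover_parent) x y -> rank y <= rank x.
Proof.
case/connectP=> s; elim: s x => [|z s IH] x /=; first by move=> _ ->.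
by move=> /andP[/cover_parentP[_ ->] zs] /(IH _ zs) /leqW.
Qed.

Lemma connect_cover_mem x y :
  connect (parent_rel cover_parent) x y -> y = x \/ y \in S.
Proof.
case/connectP=> s; elim: s x => [|z s IH] x /=; first by move=> _ ->; left.
by move=> /andP[/cover_parentP[zS _] zs] /(IH _ zs) [->|]; right.
Qed.

Lemma connect_cover x y :
  y \in S -> rank y <= rank x -> connect (parent_rel cover_parent) x y.
Proof.
move=> yS; move En: (rank x) => n; elim: n x En => [|n IH] x rx.
  by rewrite leqn0 => /eqP ry; rewrite (rank_inj yS (etrans rx (esym ry))).
rewrite leq_eqVlt => /orP[/eqP ry|le_yn].
  by rewrite (rank_inj yS (etrans rx (esym ry))).
have lt_n : n < size (enum S) by rewrite -cardE -rx.
have [z xz rz] : exists2 z, parent_rel cover_parent x z & rank z = n.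
  rewrite /parent_rel /= /cover_parent; case: pickP => [z /andP[_]|/(_ (nth x (enum S) n))].
    by rewrite rx => /eqP[rz]; exists z.
  by rewrite -mem_enum mem_nth //= /rank index_uniq ?enum_uniq // -/(rank x) rx eqxx.
exact: connect_trans (connect1 xz) (IH z rz le_yn).
Qed.

Fact cover_acyclic x y :
  cover_parent x = Some y -> ~~ connect (parent_rel cover_parent) y x.
Proof.
move/eqP => /cover_parentP[_ rx]; apply/negP => /connect_cover_rank.
by rewrite rx ltnn.
Qed.

Lemma td_cover : td G <= #|S|.+1.
Proof.
pose Y := RootedForest cover_acyclic.
apply: (@leq_trans (height Y)).
  apply: td_min; exists Y; split=> //; exists id; split=> // x y xy.
  rewrite /= /ancestor [y == x]eq_sym (adj_neq xy) /=.
  wlog le_xy : x y xy / rank x <= rank y.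
    move=> W; have [le_xy|/ltnW le_yx] := leqP (rank x) (rank y).
      exact: W.
    by rewrite orbC; apply: W => //; rewrite adj_sym.
  suff xS : x \in S by rewrite connect_cover.
  have /orP[//|yS] := coverS xy.
  (* If [y] is in [S], its rank is below [#|S|], and then so is that of [x]. *)
  by rewrite -rank_lt (leq_ltn_trans le_xy) // rank_lt.
apply/bigmax_leqP => v _.
(* The root path of [v] lies in [v |: S]; the start [v] adds one only if it is outside [S]. *)
rewrite -[#|S|.+1]add1n; apply: leq_trans (leq_add (leq_b1 (v \notin S)) (leqnn _)).
rewrite -cardsU1; apply/subset_leq_card/subsetP => u.
by rewrite !inE => /connect_cover_mem[->|->]; rewrite ?eqxx ?orbT.
Qed.

End VertexCover.

Lemma td_edgeless (G : sgraph) : (forall x y : G, ~~ x -- y) -> td G <= 1.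
Proof.
move=> noE; rewrite -(@cards0 G); apply: td_cover => x y xy.
by case/negP: (noE x y).
Qed.

(** * Upper bounds on the number of colours *)

Lemma chi_min p (G : sgraph) k (c : {ffun G -> 'I_k}) :
  td_coloring p c -> chi p G <= k.
Proof.
move=> cP; rewrite /chi; case: ex_minnP => m _; apply.
by apply/existsP; exists c.
Qed.

Lemma chi_cover p (G : sgraph) (S : {set G}) :
  (forall x y : G, x -- y -> (x \in S) || (y \in S)) -> chi p G <= #|S|.+1.
Proof.
move=> coverS.
(* The index in [enum S] is [#|S|] outside [S], so [ord_max] is the shared colour. *)
pose c := [ffun x : G => inord (index x (enum S)) : 'I_#|S|.+1].
have cE x : c x = index x (enum S) :> nat.
  by rewrite ffunE inordK // ltnS cardE index_size.
have cS x : (c x == ord_max) = (x \notin S).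
  by rewrite -val_eqE /= cE cardE -mem_enum -index_mem -leqNgt eqn_leq index_size.
have cinj : {in S &, injective c}.
  move=> x y xS yS /(congr1 val) /=; rewrite !cE => E.
  by rewrite -[x](nth_index x (s := enum S)) ?mem_enum // E nth_index ?mem_enum.
apply: (@chi_min _ _ _ c); apply/forallP => I; apply/implyP => _.
set H := induced _.
have cH (x : H) : c (val x) \in I by have := valP x; rewrite inE.
pose T := [set x : H | val x \in S].
have cT : {in T &, injective (c \o val : H -> _)}.
  by move=> x y; rewrite !inE => xS yS /(cinj _ _ xS yS)/val_inj.
(* If [I] has the shared colour, [T] covers the edges of [H] and injects into the other [#|I| - 1]
   colours. *)
have [omI|omI] := boolP (ord_max \in I).
  apply: (@leq_trans #|T|.+1).
    by apply: td_cover => x y xy; rewrite !inE; apply: coverS.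
  rewrite (cardsD1 ord_max I) omI add1n ltnS -(card_in_imset cT).
  apply/subset_leq_card/subsetP => _ /imsetP[x xT ->].
  by rewrite !inE /= cH cS andbT negbK; rewrite inE in xT.
(* Otherwise all vertices of [H] lie in [S] and have distinct colours in [I]. *)
apply: leq_trans (td_le_card H) _.
have HT (x : H) : x \in T.
  by rewrite inE -[_ \in S]negbK -cS; apply: contra omI => /eqP <-.
rewrite -(@card_in_imset _ _ (c \o val : H -> _) H); last first.
  by move=> x y _ _; apply: cT.
by apply/subset_leq_card/subsetP => _ /imsetP[x _ ->]; apply: cH.
Qed.

Lemma chi1_bipartite (G : sgraph) (A : {set G}) :
  (forall x y : G, x -- y -> (x \in A) != (y \in A)) -> chi 1 G <= 2.
Proof.
move=> bipA; pose c := [ffun x => if x \in A then ord0 else ord_max : 'I_2].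
apply: (@chi_min _ _ _ c); apply/forallP => I; apply/implyP => le_I1.
set H := induced _.
have cH (x : H) : c (val x) \in I by have := valP x; rewrite inE.
(* For empty [I] the required bound is 0, so [H] must have no vertex. *)
have [I0|I_gt0] := posnP #|I|.
  apply: leq_trans (td_le_card H) _; rewrite I0 leqNgt; apply/negP => /card_gt0P[x _].
  by have := card0_eq I0 (c (val x)); rewrite cH.
apply: leq_trans I_gt0; apply: td_edgeless => x y; apply/negP => /bipA.
have := card_le1_eqP le_I1 _ _ (cH x) (cH y); rewrite !ffunE.
by case: (_ \in A); case: (_ \in A).
Qed.

(** * Subdivided complete graphs *)

Section CompleteGraph.
Variable k : nat.

Definition complete_adj (i j : 'I_k) := i != j.

Fact complete_sym : symmetric complete_adj.
Proof. by move=> i j; rewrite /complete_adj eq_sym. Qed.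

Fact complete_irrefl : irreflexive complete_adj.
Proof. by move=> i; rewrite /complete_adj eqxx. Qed.

Definition complete_graph := SGraph complete_sym complete_irrefl.

Lemma omega_complete_graph : k <= omega complete_graph.
Proof.
rewrite -{1}[k]card_ord -cardsT.
apply: (@leq_bigmax_cond _ (@clique complete_graph) (fun A => #|A|) setT).
by apply/forall_inP => x _; apply/forall_inP => y _; apply/implyP.
Qed.

(** Branch vertices go to [A], and the one subdivision vertex of each edge gets its own vertex of
    [~: A]. The edges inject into ordered pairs, whence [k * k]. *)
Lemma TM_complete_graph r (G : sgraph) (A : {set G}) :
    (forall x y : G, x \in A -> y \notin A -> x -- y) ->
  0 < r -> k <= #|A| -> k * k <= #|~: A| -> TM r G complete_graph.
Proof.
move=> complA r_gt0 le_kA le_kB.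
have le_eB : #|{: oedge complete_graph}| <= #|~: A|.
  rewrite (leq_trans _ le_kB) // card_sig (leq_trans (max_card _)) //.
  by rewrite card_prod card_ord.
pose a (i : 'I_k) : G := enum_val (widen_ord le_kA i).
pose b (e : oedge complete_graph) : G := enum_val (widen_ord le_eB (enum_rank e)).
have aA i : a i \in A by apply: enum_valP.
have bB e : b e \notin A by rewrite -in_setC; apply: enum_valP.
have widen_inj m n (le_mn : m <= n) : injective (widen_ord le_mn).
  by move=> i j [/val_inj].
have a_inj : injective a by move=> i j /enum_val_inj/widen_inj.
have b_inj : injective b by move=> e e' /enum_val_inj/widen_inj/enum_rank_inj.
exists (fun=> 1); split=> //.
exists (fun x => match x with inl i => a i | inr s => b (tag s) end); split.
  move=> [i|s] [j|t].
  - by move/a_inj->.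
  - by move=> E; case/negP: (bB (tag t)); rewrite -E.
  - by move=> E; case/negP: (bB (tag s)); rewrite E.
  - by case: s t => [e i] [e' j] /= /b_inj E; case: _ / E j => j; rewrite !ord1.
move=> [i|s] [j|t] /=; rewrite /= /sub_arc.
- by move=> /orP[]/existsP[e]; rewrite andbF.
- by move=> _; apply: complA.
- by move=> _; rewrite adj_sym; apply: complA.
(* With one inner vertex per edge, no two subdivision vertices are adjacent. *)
- case: s t => [e [[|//] i]] [e' [[|//] j]] /=.
  by rewrite !andbF.
Qed.

End CompleteGraph.

(** Were both sides of size at least [w.+1 ^ 2], with [w] the supremum, the complete graph on [w.+1]
    vertices would be in the class and exceed [w]. *)
Lemma side_lt_omega_TM r (G : sgraph) (A : {set G}) :
    (forall x y : G, x \in A -> y \notin A -> x -- y) ->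
  0 < r -> #|A| <= #|~: A| -> #|A| < (omega_class (TM r G)).+1 ^ 2.
Proof.
move=> complA r_gt0 le_AB; rewrite ltnNge; apply/negP => le_wA.
set w := omega_class _ in le_wA.
have /(omega_class_TMP r G).2 : TM r G (complete_graph w.+1).
  apply: (TM_complete_graph complA) => //.
    by apply: leq_trans le_wA; rewrite -mulnn leq_pmulr.
  by rewrite mulnn (leq_trans le_wA).
by move/(leq_trans (omega_complete_graph _)); rewrite ltnn.
Qed.

(** * Heredity and weak boundedness *)

Lemma hereditary_complete_bipartite : hereditary complete_bipartite.
Proof.
move=> G H [A GA] [f [_ fE]]; exists (f @^-1: A) => x y.
by rewrite fE GA !inE.
Qed.

Lemma weakly_chi_bounded_complete_bipartite :
  weakly_chi_bounded complete_bipartite.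
Proof.
move=> [//|[|p]] _.
  (* For [p = 1] the class [TM 0 G] allows no subdivision vertices, so this case uses the
     2-colouring. *)
  exists (fun=> 2) => G [A GA]; apply: (@chi1_bipartite _ A) => x y.
  by rewrite GA.
exists (fun w => w.+1 ^ 2) => G [A GA].
wlog le_AB : A GA / #|A| <= #|~: A|.
  move=> W; have [/W|/ltnW le_BA] := leqP #|A| #|~: A|; first exact.
  apply: (W (~: A)); last by rewrite setCK.
  by move=> x y; rewrite GA !inE; case: (_ \in A); case: (_ \in A).
(* The strict inequality absorbs the extra colour in [#|A|.+1]. *)
apply: leq_trans (side_lt_omega_TM (A := A) _ _ le_AB) => //.
  by apply: chi_cover => x y; rewrite GA; case: (_ \in A); case: (_ \in A).
by move=> x y xA yA; rewrite GA xA (negPf yA).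
Qed.

(** * Failure of strong boundedness *)

(** Each edge joins comparable nodes of the forest, so orient it towards the ancestor. Either some
    vertex has both neighbours above it, or the orientation is cyclic and two consecutive arcs
    compose; in both cases one root path has three nodes. *)
Lemma td_C4 (G : sgraph) (a b c d : G) :
    a != c -> b != d -> a -- b -> b -- c -> c -- d -> d -- a ->
  2 < td G.
Proof.
move=> ne_ac ne_bd ab bc cd da.
have [Y [<- [f [finj fadj]]]] := td_witness_td G.
have three (u v w : G) : u != v -> u != w -> v != w ->
    connect (parent_rel (@parent Y)) (f u) (f v) ->
    connect (parent_rel (@parent Y)) (f u) (f w) -> 2 < height Y.
  move=> uv uw vw cv cw; apply: leq_trans (depth_le_height (f u)).
  have <- : #|[set f u; f v; f w]| = 3.
    by rewrite -setUA cardsU1 cards2 !inE !(inj_eq finj) negb_or uv uw vw.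
  apply/subset_leq_card/subsetP => z; rewrite !inE.
  by case/orP => [/orP[]|] /eqP ->.
have conn u v : u -- v -> connect (parent_rel (@parent Y)) (f u) (f v) \/
    connect (parent_rel (@parent Y)) (f v) (f u).
  by move/fadj => /orP[]/andP[_ ?]; [right|left].
have [ne_ab ne_bc ne_cd ne_da] := And4 (adj_neq ab) (adj_neq bc) (adj_neq cd)
  (adj_neq da).
case: (conn _ _ ab) (conn _ _ bc) (conn _ _ cd) (conn _ _ da) => {}ab
  [] {}bc [] {}cd [] {}da;
  first [ by apply: (three a b d); rewrite // eq_sym
        | by apply: (three b a c); rewrite // eq_sym
        | by apply: (three c b d); rewrite // eq_sym
        | by apply: (three d c a); rewrite // eq_sym
        | by apply: (three a b c) => //; apply: connect_trans ab bc
        | by apply: (three a d c) => //; rewrite 1?eq_sym //;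
             apply: connect_trans da cd ].
Qed.

Section BalancedBipartite.
Variable n : nat.

Definition balanced_adj (x y : bool * 'I_n) := x.1 != y.1.

Fact balanced_sym : symmetric balanced_adj.
Proof. by move=> x y; rewrite /balanced_adj eq_sym. Qed.

Fact balanced_irrefl : irreflexive balanced_adj.
Proof. by move=> x; rewrite /balanced_adj eqxx. Qed.

Definition balanced_bipartite := SGraph balanced_sym balanced_irrefl.

Lemma complete_bipartite_balanced : complete_bipartite balanced_bipartite.
Proof. by exists [set x | x.1] => x y; rewrite !inE. Qed.

(** The side map [fst] is injective on a clique. *)
Lemma omega_balanced : omega balanced_bipartite <= 2.
Proof.
apply/bigmax_leqP => A /forall_inP clA.
rewrite -card_bool -(@card_in_imset _ _ (fst : balanced_bipartite -> bool) A).
  exact: max_card.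
move=> x y xA yA exy; apply/eqP; apply: contraTT isT => ne_xy.
have /forall_inP/(_ y yA)/implyP/(_ ne_xy) := clA x xA.
by rewrite /= /balanced_adj exy eqxx.
Qed.

Lemma chi2_balanced : n <= chi 2 balanced_bipartite.
Proof.
rewrite /chi; case: ex_minnP => k /existsP[c /forallP cP] _.
rewrite leqNgt; apply/negP => lt_kn.
(* Pigeonhole on side [s], which has [n] vertices and fewer than [n] colours. *)
have same s : exists i j, i != j /\ c (s, i) = c (s, j).
  have : ~~ injectiveb (fun i => c (s, i)).
    apply/injectiveP => /leq_card; rewrite !card_ord leqNgt.
    by rewrite lt_kn.
  by case/injectivePn => i [j ne_ij eq_c]; exists i, j.
have [i [i' [ne_i ci]]] := same true; have [j [j' [ne_j cj]]] := same false.
pose I := [set c (true, i); c (false, j)].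
have le_I2 : #|I| <= 2 by rewrite cards2; case: (_ != _).
have := leq_trans (implyP (cP I) le_I2) le_I2; rewrite leqNgt => /negP; apply.
have mem x : c x = c (true, i) \/ c x = c (false, j) ->
  x \in [set x | c x \in I] by rewrite !inE => -[]->; rewrite eqxx ?orbT.
(* The 4-cycle alternates between the two monochromatic pairs, inside the subgraph induced by
   [I]. *)
pose v x Hx : induced [set x | c x \in I] := exist _ x (mem x Hx).
apply: (@td_C4 _ (v (true, i) (or_introl erefl)) (v (false, j) (or_intror erefl))
  (v (true, i') (or_introl (esym ci))) (v (false, j') (or_intror (esym cj)))) => //.
Qed.

End BalancedBipartite.

Lemma not_strongly_chi_bounded_complete_bipartite :
  ~ strongly_chi_bounded complete_bipartite.
Proof.
(* [n] exceeds [f] at 0, 1 and 2, the only clique numbers that [omega_balanced] allows. *)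
move=> /(_ 2 isT) [f fP]; pose n := (maxn (f 0) (maxn (f 1) (f 2))).+1.
have := leq_trans (chi2_balanced n) (fP _ (complete_bipartite_balanced n)).
have := omega_balanced n; case: (omega _) => [|[|[|//]]] _;
  by rewrite ltnNge !leq_max leqnn ?orbT.
Qed.

Theorem proposition2 :
  hereditary complete_bipartite /\
  weakly_chi_bounded complete_bipartite /\
  ~ strongly_chi_bounded complete_bipartite.
Proof.
split; first exact: hereditary_complete_bipartite.
split; first exact: weakly_chi_bounded_complete_bipartite.
exact: not_strongly_chi_bounded_complete_bipartite.
Qed.
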